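(* Let $A$ be a finite set with $|A|\ge 3$. The coatoms of $\mathcal{E}$ are exactly the congruence lattices of the form $\operatorname{Con}(A,f)$ where $f\in A^A$ satisfies one of the following: (I) $f$ is nontrivial and $f^2=f$; or (II) $f$ is nontrivial, $f^2$ is a constant mapping, say with value $0\in A$, and $|\{x\in A\mid f(x)=f(0)\}|\ge 3$; or (III) $f^p=\operatorname{id}_A$ for some prime $p$ such that the permutation $f$ has at least two cycles of length $p$.
   Context: $\operatorname{Eq}(A)$ is the set of all equivalence relations on $A$. A mapping $f\colon A\to A$ preserves $\kappa\in\operatorname{Eq}(A)$ if $(x,y)\in\kappa$ implies $(f(x),f(y))\in\kappa$. For $F\subseteq A^A$, $\operatorname{Con}(A,F)$ is the set of all $\kappa\in\operatorname{Eq}(A)$ preserved by every $f\in F$, and $\operatorname{Con}(A,f):=\operatorname{Con}(A,\{f\})$. $\mathcal{E}:=\{\operatorname{Con}(A,F)\mid F\subseteq A^A\}$, ordered by inclusion; it is a lattice with greatest element $\operatorname{Eq}(A)$. A coatom is an element covered by the greatest element. $f\in A^A$ is called trivial if it is the identity $\operatorname{id}_A$ or a constant mapping; otherwise it is nontrivial. $f^n$ is the $n$-fold composition of $f$. In (II), the set $\{x\in A\mid f(x)=f(0)\}$ is the class of $0$ modulo the kernel of $f$ (and $f(0)=0$ since $f^2$ is constant with value $0$). *)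

(* Defs.v *)
From mathcomp Require Import all_boot all_fingroup.

Set Implicit Arguments.
Unset Strict Implicit.
Unset Printing Implicit Defensive.

Section CongruenceLattices.

Variable A : finType.

(* A binary relation on A is a set of pairs, so that sets of relations, and  *)
(* sets of those, are finite sets ordered by inclusion (\subset).            *)
Implicit Types (kappa : {set A * A}) (f : {ffun A -> A}).
Implicit Types (F : {set {ffun A -> A}}) (L M : {set {set A * A}}).

Definition is_equiv kappa : bool :=
  [&& [forall x, (x, x) \in kappa],
      [forall x, forall y, ((x, y) \in kappa) ==> ((y, x) \in kappa)]
    & [forall x, forall y, forall z,
         ((x, y) \in kappa) && ((y, z) \in kappa) ==> ((x, z) \in kappa)]].

Definition Eq : {set {set A * A}} := [set kappa | is_equiv kappa].

Definition preserves f kappa : bool :=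
  [forall x, forall y, ((x, y) \in kappa) ==> ((f x, f y) \in kappa)].

Definition Con F : {set {set A * A}} :=
  [set kappa in Eq | [forall f in F, preserves f kappa]].

Definition Con1 f : {set {set A * A}} := Con [set f].

Definition cong_lattices : {set {set {set A * A}}} :=
  [set Con F | F : {set {ffun A -> A}}].

Lemma Eq_in_cong_lattices : Eq \in cong_lattices.
Proof.
apply/imsetP; exists set0 => //; apply/setP => kappa.
rewrite [RHS]inE; case: (kappa \in Eq) => //=.
by symmetry; apply/forall_inP => f; rewrite inE.
Qed.

Lemma cong_lattices_sub_Eq L : L \in cong_lattices -> L \subset Eq.
Proof.
by case/imsetP => F _ ->; apply/subsetP => kappa; rewrite inE => /andP[].
Qed.

Definition covered_in (P : {set {set {set A * A}}}) L M : Prop :=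
  [/\ L \in P, M \in P, L \proper M
    & forall K, K \in P -> ~~ ((L \proper K) && (K \proper M))].

Definition coatom L : Prop := covered_in cong_lattices L Eq.

Definition trivial_map f : Prop := f =1 id \/ exists c : A, forall x, f x = c.

Definition type_I f : Prop :=
  ~ trivial_map f /\ (forall x, iter 2 f x = f x).

Definition type_II f : Prop :=
  ~ trivial_map f /\
  exists o : A, (forall x, iter 2 f x = o) /\ 3 <= #|[set x | f x == f o]|.

(* s is f bundled as a permutation; porbits s is the set of its cycles. *)
Definition type_III f : Prop :=
  exists p : nat,
    [/\ prime p, iter p f =1 id
      & exists2 s : {perm A}, f =1 s
          & 2 <= #|[set C in porbits s | #|C| == p]|].

End CongruenceLattices.

Arguments Eq A : clear implicits.

(* Main.v *)
Require Import Defs.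
From mathcomp Require Import all_boot all_fingroup cyclic.

Set Implicit Arguments.
Unset Strict Implicit.
Unset Printing Implicit Defensive.

(** A lattice [Con F] is the intersection of the lattices [Con1 f] for [f] in
    [F], and [Con1 f] is everything exactly when [f] is trivial (this is where
    three points are needed: on two points the swap preserves all equivalences).
    Hence the coatoms are the maximal lattices among the [Con1 f] with [f]
    nontrivial. Writing [Con_le f g] for the inclusion of [Con1 f] in [Con1 g],
    the theorem amounts to two facts.

    Every nontrivial [f] lies below a map of type I, II or III
    ([nontrivial_above]). Some positive iterate of [f] is idempotent. If that iterate is
    nontrivial, it has type I. If it is the identity, then [f] is a permutation
    and has a power of prime order. If it is constant, then the last
    non-constant iterate of [f] has a constant square. The power so found has
    type III or II, unless it has only one nontrivial cycle, respectively a
    kernel class of the constant with just two elements; in these degenerate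
    cases its congruences are also preserved by an explicit idempotent map
    ([prime_perm_above], [square_const_above]).

    The three types are maximal: if [f] is of type I, II or III, [g] is
    nontrivial and [Con_le f g], then [Con_le g f] ([idempotent_max],
    [square_const_max], [prime_perm_max]). Here one tests [g] on congruences of
    [f] with very small blocks, obtained as kernels of suitable functions
    ([Con_le_kernel]). Typically two points [x] and [y] are identified, together
    with whatever [f] then forces, so that [g x] and [g y] are equal or lie in a
    common small block. This pins [g] down: it is [f] (a power of [f] in type
    III) or one of a few exceptional maps, from which the congruences of [f]
    are recovered by inspection. *)

(** * Comparing the congruence lattices of two maps *)

Section Maps.

Variable A : finType.
Implicit Types (f g h : A -> A) (k : rel A) (B S : {set A}) (x y z u v : A).

Definition compatible f k := forall x y, k x y -> k (f x) (f y).

(** Inclusion of [Con1 f] in [Con1 g], for plain functions rather than finite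
    ones, so that iterates and permutations can be compared directly; see
    [Con1_sub]. *)
Definition Con_le f g := forall k,
  reflexive k -> symmetric k -> transitive k -> compatible f k -> compatible g k.

(** The version of [trivial_map] for plain functions; on the finite function
    underlying [f] both are convertible. *)
Definition trivial_fun f := f =1 id \/ exists c, forall x, f x = c.

Lemma Con1P (f : {ffun A -> A}) (kappa : {set A * A}) :
  reflect (is_equiv kappa /\ compatible f (fun x y => (x, y) \in kappa))
          (kappa \in Con1 f).
Proof.
rewrite /Con1 /Con !inE; apply: (iffP andP) => -[keq] kf; split=> //.
  move/forall_inP/(_ f (set11 f)): kf => kf x y.
  by have /forallP/(_ y)/implyP := forallP kf x.
apply/forall_inP => _ /set1P ->.
by apply/forallP => x; apply/forallP => y; apply/implyP; apply: kf.
Qed.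

Lemma is_equivP (kappa : {set A * A}) (k := fun x y => (x, y) \in kappa) :
  reflect [/\ reflexive k, symmetric k & transitive k] (is_equiv kappa).
Proof.
apply: (iffP and3P) => [[kr ks kt]|[kr ks kt]].
  have ksym x y : k x y -> k y x.
    by have /forallP/(_ y)/implyP := forallP ks x.
  split=> [x|x y|y x z xy yz]; first exact: (forallP kr).
    by apply/idP/idP; apply: ksym.
  have /forallP/(_ y)/forallP/(_ z)/implyP := forallP kt x.
  by apply; rewrite -[_ \in _]/(k x y) -[(y, z) \in _]/(k y z) xy.
split; first by apply/forallP.
  by apply/forallP=> x; apply/forallP=> y; apply/implyP; rewrite -[_ \in _]/(k x y) ks.
apply/forallP=> x; apply/forallP=> y; apply/forallP=> z; apply/implyP => /andP[].
exact: kt.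
Qed.

Lemma Con1_sub (f g : {ffun A -> A}) : Con1 f \subset Con1 g <-> Con_le f g.
Proof.
split=> [/subsetP fg k kr ks kt kf x y kxy | fg]; last first.
  apply/subsetP => kappa /Con1P[keq kf]; apply/Con1P; split=> //.
  by have [kr ks kt] := is_equivP _ keq; apply: fg.
have kE u v : ((u, v) \in [set w : A * A | k w.1 w.2]) = k u v by rewrite inE.
have /fg/Con1P[_ /(_ x y)] : [set w : A * A | k w.1 w.2] \in Con1 f.
  apply/Con1P; split; last by move=> u v; rewrite !kE; apply: kf.
  by apply/is_equivP; split=> [u|u v|v u w]; rewrite !kE //; apply: kt.
by rewrite !kE; apply.
Qed.

Lemma Con_le_iter f n : Con_le f (iter n f).
Proof. by move=> k _ _ _ kf x y kxy; elim: n => //= n; apply: kf. Qed.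

Lemma Con_le_trans f g h : Con_le f g -> Con_le g h -> Con_le f h.
Proof. by move=> fg gh k kr ks kt kf; apply: gh => //; apply: fg. Qed.

Lemma Con_le_eq f g h : g =1 h -> Con_le f g -> Con_le f h.
Proof. by move=> gh fg k kr ks kt kf x y kxy; rewrite -!gh; apply: fg. Qed.

(** The kernel of any [h] is an equivalence relation, and the hypothesis says
    that [f] preserves it. All constraints on [g] derived below come from this
    lemma: congruences of [f] are described by functions [h], so that no
    equivalence axioms have to be checked. *)
Lemma Con_le_kernel f g (T : eqType) (h : A -> T) : Con_le f g ->
    (forall x y, h x = h y -> h (f x) = h (f y)) ->
  forall x y, h x = h y -> h (g x) = h (g y).
Proof.
move=> fg hf x y hxy; apply/eqP.
apply: (fg (fun u v => h u == h v)); last exact/eqP.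
- by move=> u.
- by move=> u v; rewrite eq_sym.
- by move=> v u w /eqP->.
- by move=> u v /eqP/hf->.
Qed.

(** The test congruence collapses [B] and separates all other points. *)
Lemma Con_le_block f g B : Con_le f g ->
    {in B &, forall x y, f x = f y \/ f x \in B /\ f y \in B} ->
  {in B &, forall x y, g x = g y \/ g x \in B /\ g y \in B}.
Proof.
move=> fg fB x y xB yB.
pose h z := if z \in B then None else Some z.
have hE u v : h u = h v -> u = v \/ u \in B /\ v \in B.
  by rewrite /h; case: ifP => uB; case: ifP => vB //; [right|case=> ->; left].
apply/hE/(Con_le_kernel fg); last by rewrite /h xB yB.
move=> u v /hE[-> // | [uB vB]].
by case: (fB u v uB vB) => [-> // | [fuB fvB]]; rewrite /h fuB fvB.
Qed.

(** The test congruence has the two blocks [{x, y}] and [{f x, f y}]. The last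
    hypothesis makes it preserved by idempotent maps as well as by maps with a
    constant square. *)
Lemma Con_le_pair f g x y : Con_le f g ->
    x \notin [set f x; f y] -> y \notin [set f x; f y] ->
    f (f x) = f (f y) \/ f (f x) = f x /\ f (f y) = f y ->
  [\/ g x = g y, g x \in [set x; y] /\ g y \in [set x; y]
    | g x \in [set f x; f y] /\ g y \in [set f x; f y]].
Proof.
set B := [set x; y]; set C := [set f x; f y] => fg xC yC ff.
have BC z : z \in B -> z \notin C by case/set2P=> ->.
pose h z := if z \in B then inl true else if z \in C then inl false else inr z.
have hB z : z \in B -> h z = inl true by rewrite /h => ->.
have hC z : z \in C -> h z = inl false.
  by rewrite /h => zC; rewrite zC; case: ifP => // /BC; rewrite zC.
have hE u v : h u = h v -> [\/ u = v, u \in B /\ v \in B | u \in C /\ v \in C].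
  rewrite /h; case uB: (u \in B); case vB: (v \in B);
    case uC: (u \in C); case vC: (v \in C) => // e;
  by [constructor 2 | constructor 3 | constructor 1; case: e].
apply/hE/(Con_le_kernel fg); last by rewrite !hB ?set21 ?set22.
move=> u v /hE[-> // | [] | []].
  have fBC z : z \in B -> f z \in C by case/set2P=> ->; rewrite ?set21 ?set22.
  by move=> /fBC/hC -> /fBC/hC ->.
case: ff => [e | [ex ey]].
  have fC z : z \in C -> f z = f (f x) by case/set2P=> ->.
  by move=> /fC -> /fC ->.
have fC z : z \in C -> f z = z by case/set2P=> ->.
by move=> uC vC; rewrite !fC // !hC.
Qed.

(** The constraint put on [g] by all congruences with one block of size two. If
    [g x <> g y], then [g] fixes or exchanges [x] and [y]; comparing a third
    point with both, it is fixed in the first case and cannot exist in the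
    second. *)
Lemma id_const_or_swap S g :
    {in S &, forall x y, g x = g y \/ g x \in [set x; y] /\ g y \in [set x; y]} ->
  [\/ {in S, g =1 id}, exists c, {in S, forall x, g x = c}
    | exists a b, [/\ a != b, S = [set a; b], g a = b & g b = a]].
Proof.
move=> gS; case: (set_0Vmem S) => [-> | [x xS]].
  by constructor 1 => x; rewrite inE.
have [gc | ] := boolP [forall z in S, g z == g x].
  by constructor 2; exists (g x) => z zS; apply/eqP/(forall_inP gc).
rewrite negb_forall_in => /exists_inP[y yS /eqP gyx].
have xy : x != y by apply: contra_not_neq gyx => ->.
have [e | [/set2P[gx|gx] /set2P[gy|gy]]] := gS x y xS yS.
- by case: gyx.
- by case: gyx; rewrite gx gy.
- have gz z u : z \in S -> u \in S -> g u = u -> g z = u \/ g z = z.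
    move=> zS uS gu; have [e|[_ /set2P//]] := gS u z uS zS.
    by left; rewrite -e.
  constructor 1 => z zS /=; have [gzx|//] := gz z x zS xS gx.
  have [gzy|//] := gz z y zS yS gy.
  by case: gyx; rewrite gx gy -gzx.
- constructor 3; exists x, y; split=> //; apply/setP=> z; rewrite !inE.
  apply/idP/orP => [zS | [] /eqP-> //].
  have [e1|[/set2P[e1|e1] _]] := gS x z xS zS.
  + have [e2|[/set2P[e2|e2] _]] := gS y z yS zS.
    * by case: gyx; rewrite e1.
    * by case: gyx; rewrite gx -e2 e2.
    * by left; rewrite -e2 gy.
  + by case: gyx; rewrite gy e1.
  + by right; rewrite -e1 gx.
- by case: gyx; rewrite gx gy.
Qed.

Lemma nontrivial_Con_id g : 3 <= #|A| -> Con_le id g -> trivial_fun g.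
Proof.
move=> A3 idg.
have gT : {in setT &, forall x y,
    g x = g y \/ g x \in [set x; y] /\ g y \in [set x; y]}.
  by move=> x y _ _; apply: (Con_le_block idg); rewrite ?set21 ?set22 //; right.
case: (id_const_or_swap gT) => [gid | [c gc] | [a [b [ab AE _ _]]]].
- by left=> x; apply: gid.
- by right; exists c => x; apply: gc.
- by move: A3; rewrite -cardsT AE cards2 ab.
Qed.

(** On the image [I] of [f] every pair is a block of a congruence, so [g] is
    there the identity, a constant [c], or a swap of two points. In the first
    case [g] must be [f]. In the second, [g] is not [f], but one of two maps with
    the same congruences: either [f] sends the complement of [I] to [c] and [g]
    fixes it, or [c] is the only point outside [I] and [g] sends [c] to [f c] and
    everything else to [c]. In the third case [g] is [f] followed by the swap, so
    [f] is the square of [g]. *)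
Lemma idempotent_max f g : f \o f =1 f -> ~ trivial_fun f ->
  ~ trivial_fun g -> Con_le f g -> Con_le g f.
Proof.
move=> ff fN gN fg; pose I := [set x | f x == x].
have ffx x : f (f x) = f x by apply: ff.
have IP x : reflect (f x = x) (x \in I) by rewrite inE; apply: eqP.
have fI x : f x \in I by apply/IP.
have neqI x y : x \in I -> y \notin I -> x <> y.
  by move=> xI /negP yI xy; rewrite -xy in yI.
have gI : {in I &, forall x y, g x = g y \/ g x \in [set x; y] /\ g y \in [set x; y]}.
  move=> x y /IP fx /IP fy; apply: (Con_le_block fg); rewrite ?set21 ?set22 //.
  by move=> u v uS vS; right; case/set2P: uS vS => -> /set2P[]->; rewrite ?fx ?fy ?set21 ?set22.
have gfx x : g x = g (f x) \/ g x \in [set x; f x] /\ g (f x) \in [set x; f x].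
  apply: (Con_le_block fg); rewrite ?set21 ?set22 // => u v /set2P[]-> /set2P[]->;
  by rewrite ?ffx; left.
have gNI x y : x \notin I -> y \notin I ->
    [\/ g x = g y, g x \in [set x; y] /\ g y \in [set x; y]
      | g x \in [set f x; f y] /\ g y \in [set f x; f y]].
  move=> xI yI; apply: Con_le_pair; rewrite ?ffx //; last by right.
    by apply: contra xI => /set2P[]->.
  by apply: contra yI => /set2P[]->.
case: (id_const_or_swap gI) => [gid | [c gc] | [a [b [ab IE ga gb]]]].
- have gx x : g x = x \/ g x = f x.
    by have [e|[/set2P[] ? _]] := gfx x; [right; rewrite e gid | left | right].
  have [/forallP gidT | ] := boolP [forall x, g x == x].
    by case: gN; left=> x; apply/eqP.
  rewrite negb_forall => /existsP[x gxx].
  have gxf : g x = f x by case: (gx x) gxx => [->|//]; rewrite eqxx.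
  have xI : x \notin I by apply: contra gxx => /gid/eqP.
  suff gf : g =1 f by apply: (Con_le_eq gf).
  move=> y; have [yI|yI] := boolP (y \in I); first by rewrite gid // (IP _ yI).
  have [gy|//] := gx y.
  have [] := gNI x y xI yI; rewrite gxf gy.
  + by move/neqI; case.
  + by case=> /set2P[]/neqI; case.
  + by case=> _ /set2P[]/esym/neqI; case.
- have [cI|cI] := boolP (c \in I).
  + have gx x : x \notin I -> g x = c \/ g x = x /\ f x = c.
      move=> xI; have := gfx x; rewrite (gc (f x)) //.
      case=> [|[gx /set2P[cx|cx]]]; [by left| by rewrite -cx cI in xI |].
      by case/set2P: gx => gx; [right | left; rewrite gx -cx].
    have [/forallP gcT | ] := boolP [forall x, g x == c].
      by case: gN; right; exists c => x; apply/eqP.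
    rewrite negb_forall => /existsP[x gxc].
    have xI : x \notin I by apply: contra gxc => /gc/eqP.
    have [gxx fxc] : g x = x /\ f x = c by case: (gx x xI) gxc => [->|//]; rewrite eqxx.
    have gout y : y \notin I -> g y = y /\ f y = c.
      move=> yI; case: (gx y yI) => // gy.
      have [] := gNI x y xI yI; rewrite gxx gy.
      * by move/esym/neqI; case.
      * by case=> _ /set2P[]/neqI; case.
      * by case=> /set2P[]/esym/neqI; case.
    move=> k kr ks kt kg u v kuv; have := kg _ _ kuv.
    have [uI|/gout[gu ->]] := boolP (u \in I);
      have [vI|/gout[gv ->]] := boolP (v \in I).
    * by rewrite !(IP _ _).
    * by rewrite gc // (IP _ uI) gv ks => /(kt _ _ _ kuv).
    * by rewrite [g v]gc // (IP _ vI) gu ks => kcu; apply: kt kcu kuv.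
    * by [].
  + have gx x : x != c -> g x = c.
      move=> xc; have [/gc //|xI] := boolP (x \in I).
      have := gfx x; rewrite (gc (f x)) //.
      case=> [//|[_ /set2P[cx|cx]]]; first by rewrite cx eqxx in xc.
      by rewrite cx fI in cI.
    have gcc : g c = f c.
      have gcN : g c <> c.
        by move=> gcc; case: gN; right; exists c => x; have [->|/gx] := eqVneq x c.
      have := gfx c; rewrite (gc (f c)) //.
      by case=> [//|[/set2P[]]].
    have outI y : y != c -> f y = y.
      move=> yc; apply/IP; apply/negPn/negP => yI.
      have [] := gNI c y cI yI; rewrite gcc gx //.
      * by move/neqI; case.
      * by case=> /set2P[]/neqI; case.
      * by case=> _ /set2P[]/esym/neqI; case.
    move=> k kr ks kt kg.
    have kfc y : y != c -> k c y -> k (f c) (f y).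
      by move=> yc kcy; have := kg _ _ kcy; rewrite gcc (gx y yc) (outI y yc) => /kt; apply.
    move=> u v; case: (eqVneq u c) => [->|uc]; case: (eqVneq v c) => [->|vc] //.
    * exact: kfc.
    * by rewrite ks (ks (f u)); apply: kfc.
    * by rewrite !outI.
- have swapf x : g (g x) = f x.
    have gI2 y : y \in I -> g (g y) = y by rewrite IE => /set2P[]->; rewrite ?ga ?gb.
    have [xI|xI] := boolP (x \in I); first by rewrite gI2 // (IP _ xI).
    have [->|[gx gfx2]] := gfx x; first exact: gI2.
    have gfxI : g (f x) \in I.
      by have := fI x; rewrite IE => /set2P[]->; rewrite ?ga ?gb ?set21 ?set22.
    case/set2P: gfx2 => e; first by rewrite -e gfxI in xI.
    have := fI x; rewrite IE => /set2P[] fx; move: e; rewrite fx ?ga ?gb => /eqP.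
      by rewrite eq_sym (negPf ab).
    by rewrite (negPf ab).
  by apply: (Con_le_eq swapf); apply: (@Con_le_iter g 2).
Qed.

(** On the zero set [Z] of [f] every pair is a block of a congruence and [Z] has
    three elements, so [g] is there the identity or a constant [c]. The
    identity would propagate to all of [A]. For [c = o] the map [g] must be [f];
    for [c <> o] the maps [f] and [g] both take only the values [o] and [c],
    with kernel classes [Z] and its complement, and they differ by exchanging
    these values. *)
Lemma square_const_max f g o (Z := [set x | f x == o]) :
    (forall x, f (f x) = o) -> 3 <= #|Z| -> ~ trivial_fun f ->
  ~ trivial_fun g -> Con_le f g -> Con_le g f.
Proof.
move=> ff Z3 fN gN fg.
have ZP x : reflect (f x = o) (x \in Z) by rewrite inE; apply: eqP.
have fZ x : f x \in Z by apply/ZP.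
have fo : f o = o by rewrite -{1}(ff o) ff.
have oZ : o \in Z by apply/ZP.
have neqZ x y : x \in Z -> y \notin Z -> x <> y.
  by move=> xI /negP yI xy; rewrite -xy in yI.
have gZ : {in Z &, forall x y, g x = g y \/ g x \in [set x; y] /\ g y \in [set x; y]}.
  move=> x y /ZP fx /ZP fy; apply: (Con_le_block fg); rewrite ?set21 ?set22 //.
  by move=> u v uS vS; left; case/set2P: uS vS => -> /set2P[]->; rewrite ?fx ?fy.
have pairNN x y : x \notin Z -> y \notin Z ->
    [\/ g x = g y, g x \in [set x; y] /\ g y \in [set x; y]
      | g x \in [set f x; f y] /\ g y \in [set f x; f y]].
  move=> xZ yZ; apply: Con_le_pair; rewrite ?ff //; last by left.
    by apply: contra xZ => /set2P[]->.
  by apply: contra yZ => /set2P[]->.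
(* The third element of Z besides o and f x yields a test pair whose two blocks
   are disjoint. *)
have pairNZ x : x \notin Z -> exists z, [/\ z \in Z, z != o, z != f x &
    [\/ g x = g z, g x \in [set x; z] /\ g z \in [set x; z]
      | g x \in [set f x; o] /\ g z \in [set f x; o]]].
  move=> xZ; have /subsetPn[z zZ] : ~~ (Z \subset [set f x; o]).
    apply: contraL Z3 => /subset_leq_card le; rewrite -ltnNge ltnS (leq_trans le) //.
    by rewrite cards2; case: eqP.
  move=> zN; have /andP[zfx zo] : (z != f x) && (z != o).
    by move: zN; rewrite !inE negb_or.
  exists z; split=> //.
  have := @Con_le_pair f g x z fg; rewrite (ZP z zZ); apply.
  - by apply: contra xZ => /set2P[]->.
  - by rewrite !inE negb_or zfx.
  - by left; rewrite ff fo.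
have fNZ x : x \notin Z -> f x <> o by move=> /negP xZ /ZP.
have gblock x : g x = g o \/ g x \in [set x; f x; o] /\ g o \in [set x; f x; o].
  apply: (Con_le_block fg); rewrite ?inE ?eqxx ?orbT // => u v uB vB; right.
  have fB w : w \in [set x; f x; o] -> f w \in [set x; f x; o].
    by rewrite !inE => /orP[/orP[]|] /eqP->; rewrite ?ff ?fo eqxx ?orbT.
  by split; apply: fB.
case: (id_const_or_swap gZ) => [gid | [c gc] | [a [b [ab ZE _ _]]]].
- case: gN; left=> x; have [/gid//|xZ] := boolP (x \in Z).
  have [z [zZ zo zfx]] := pairNZ x xZ; rewrite (gid z zZ).
  have gxB : g x \in [set x; f x; o].
    by have [->|[]//] := gblock x; rewrite (gid o oZ) !inE eqxx orbT.
  have gxz : g x != z.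
    apply: contraNneq zo => gxz; move: gxB; rewrite gxz !inE (negPf zfx) orbF.
    by case/orP=> // /eqP/neqZ; case.
  case=> [/eqP|[/set2P[//|/eqP]]|[_]]; rewrite ?(negPf gxz) //.
  by rewrite !inE (negPf zfx) (negPf zo).
- have gout x : x \notin Z -> g x != c -> g x \in [set f x; o] /\ c \in [set f x; o].
    move=> xZ gxc; have [z [zZ zo zfx]] := pairNZ x xZ; rewrite (gc z zZ).
    case=> [/eqP|[gx cx]|//]; first by rewrite (negPf gxc).
    have := gblock x; rewrite (gc o oZ) => -[/eqP|[gxB cB]]; first by rewrite (negPf gxc).
    have zB : z \notin [set x; f x; o].
      by rewrite !inE (negPf zo) (negPf zfx) !orbF; apply/eqP => /neqZ; case.
    case/set2P: cx gx => cx /set2P[] gx.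
    + by rewrite gx cx eqxx in gxc.
    + by rewrite gx (negPf zB) in gxB.
    + by rewrite cx (negPf zB) in cB.
    + by rewrite cx (negPf zB) in cB.
  have [/forallP gcT | ] := boolP [forall x, g x == c].
    by case: gN; right; exists c => x; apply/eqP.
  rewrite negb_forall => /existsP[x gxc].
  have xZ : x \notin Z by apply: contra gxc => /gc/eqP.
  have [gx cfx] := gout x xZ gxc.
  have [co|co] := eqVneq c o.
  + have gxf : g x = f x by case/set2P: gx gxc => -> //; rewrite co eqxx.
    suff gf : g =1 f by apply: (Con_le_eq gf).
    move=> y; have [yZ|yZ] := boolP (y \in Z); first by rewrite gc // (ZP _ yZ).
    have [gyc|gyc] := eqVneq (g y) c; last first.
      by have [/set2P[//|e] _] := gout y yZ gyc; rewrite e co eqxx in gyc.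
    have [] := pairNN x y xZ yZ; rewrite gyc co gxf.
    * by move/fNZ: xZ.
    * by case=> _ /set2P[]/neqZ; case.
    * by case=> _ /set2P[]/esym; [move/fNZ: xZ | move/fNZ: yZ].
  + have gxo : g x = o.
      case/set2P: cfx gx => [cfx /set2P[gx|//]|cfx]; last by rewrite cfx eqxx in co.
      by rewrite cfx gx eqxx in gxc.
    have gf y : y \notin Z -> g y = o /\ f y = c.
      move=> yZ; have [gyc|gyc] := eqVneq (g y) c.
        have [] := pairNN x y xZ yZ; rewrite gyc gxo.
        * by move/eqP; rewrite eq_sym (negPf co).
        * by case=> /set2P[]/neqZ; case.
        * by case=> /set2P[]/esym; [move/fNZ: xZ | move/fNZ: yZ].
      have [gy /set2P[cy|cy]] := gout y yZ gyc; last by rewrite cy eqxx in co.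
      by case/set2P: gy => // gy; rewrite gy cy eqxx in gyc.
    move=> k kr ks kt kg u v kuv; have := kg _ _ kuv.
    have [uZ|/gf[-> ->]] := boolP (u \in Z); have [vZ|/gf[-> ->]] := boolP (v \in Z).
    * by rewrite (ZP _ uZ) (ZP _ vZ).
    * by rewrite (gc u uZ) (ZP _ uZ) ks.
    * by rewrite (gc v vZ) (ZP _ vZ) ks.
    * by [].
- by move: Z3; rewrite ZE cards2 ab.
Qed.

End Maps.

(** * Permutations of prime order *)

(** [n] is invertible modulo [p], so [a] is a power of [a ^+ n]. *)
Lemma expg_prime_root (gT : finGroupType) (a : gT) p n : prime p ->
  (a ^+ p = 1)%g -> ~~ (p %| n) -> exists m, ((a ^+ n) ^+ m = a)%g.
Proof.
move=> pP ap pn; have cop : coprime p n by rewrite prime_coprime.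
pose m := chinese p n 1 0.
have nm : n %| m by rewrite /dvdn chinese_modr // mod0n.
exists (m %/ n); rewrite -expgM mulnC divnK // -(expg_mod _ ap).
by rewrite chinese_modl // expg_mod // expg1.
Qed.

Section PrimeOrder.

Variable A : finType.
Implicit Types (x y z : A) (s : {perm A}).

Section Perm.

Variables (s : {perm A}) (p : nat).
Hypotheses (pP : prime p) (sp : (s ^+ p = 1)%g).

Lemma perm_expS i x : s ((s ^+ i)%g x) = (s ^+ i.+1)%g x.
Proof. by rewrite expgSr permM. Qed.

Lemma perm_exp_fix i x : s x = x -> (s ^+ i)%g x = x.
Proof. by move=> sx; rewrite permX; elim: i => //= i ->. Qed.

Lemma mem_porbitS x y : (s y \in porbit s x) = (y \in porbit s x).
Proof. by rewrite -!eq_porbit_mem -[s y]/((s ^+ 1)%g y) porbit_perm. Qed.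

Lemma moved_dvdn x n : s x != x -> (s ^+ n)%g x = x -> p %| n.
Proof.
move=> sx snx; apply: contraNT sx => /(expg_prime_root pP sp)[m sE].
by rewrite -{1}sE permX; elim: m {sE} => //= m /eqP->; rewrite snx.
Qed.

Lemma moved_expg_inj x i j : s x != x ->
  (s ^+ i)%g x = (s ^+ j)%g x -> (s ^+ i = s ^+ j)%g.
Proof.
move=> sx; wlog ij : i j / i <= j => [W|].
  by case/orP: (leq_total i j) => ij e; [apply: W | symmetry; apply: W].
rewrite -(subnK ij) expgD permM => /perm_inj/esym/(moved_dvdn sx)/dvdnP[m ->].
by rewrite mulnC expgM sp expg1n mul1g.
Qed.

(** Mapping the orbit of [x] equivariantly onto that of [y] is well defined
    because the orbit of a moved point has full length. For [y]
    outside the orbit of [x], the kernel of this map is the least congruence of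
    [s] that relates [x] and [y]; if [y] is a fixed point, it collapses the
    cycle of [x] together with [y]. *)
Lemma orbit_map x y : s x != x -> exists h : A -> A,
  [/\ forall i, h ((s ^+ i)%g x) = (s ^+ i)%g y,
      forall z, z \notin porbit s x -> h z = z & forall z, h (s z) = s (h z)].
Proof.
move=> sx; pose h z := if [pick i : 'I_(#[s]%g) | z == (s ^+ i)%g x] is Some i
  then (s ^+ i)%g y else z.
have h_on i : h ((s ^+ i)%g x) = (s ^+ i)%g y.
  rewrite /h; case: pickP => [j /eqP/(moved_expg_inj sx)-> // | none].
  have [j ltj e] := porbitPmin (mem_porbit s i x).
  by have := none (Ordinal ltj); rewrite e eqxx.
have h_off z : z \notin porbit s x -> h z = z.
  by rewrite /h; case: pickP => // i /eqP->; rewrite mem_porbit.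
exists h; split=> // z; have [/porbitP[i ->]|zC] := boolP (z \in porbit s x).
  by rewrite h_on !perm_expS h_on.
by rewrite !h_off ?mem_porbitS.
Qed.

Lemma Con_le_orbit_map (g : A -> A) x y : Con_le s g -> s x != x ->
  y \notin porbit s x -> exists h : A -> A,
  [/\ forall i, h ((s ^+ i)%g x) = (s ^+ i)%g y,
      forall z, z \notin porbit s x -> h z = z & h (g x) = h (g y)].
Proof.
move=> sg sx yC; have [h [h_on h_off hs]] := orbit_map y sx.
exists h; split=> //; apply: (Con_le_kernel sg) => [u v e|].
  by rewrite !hs e.
by rewrite (h_off y) // -[x in LHS]perm1 (h_on 0) perm1.
Qed.

Lemma moved_porbit x y : y \in porbit s x -> s x != x -> s y != y.
Proof.
case/porbitP=> i ->; apply: contraNneq.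
by rewrite -permM -expgSr expgS permM => /perm_inj->.
Qed.

(** If [g] moved some nontrivial cycle off itself, it would be constant there,
    and the congruences identifying this cycle with other orbits would force [g]
    to be constant everywhere. So [g] preserves each nontrivial cycle, hence
    fixes the fixed points of [s] (any fixed point is squeezed between two
    cycles), and acts on all cycles as the same power of [s]. As [g] is not
    the identity and [p] is prime, [s] is in turn a power of [g]. *)
Lemma prime_perm_max (g : A -> A) x0 y0 : s x0 != x0 -> s y0 != y0 ->
  y0 \notin porbit s x0 -> ~ trivial_fun g -> Con_le s g -> Con_le g s.
Proof.
move=> sx0 sy0 yx0 gN sg.
have gC x : s x != x -> g x \in porbit s x.
  move=> sx; apply/negPn/negP => cC; set c := g x in cC.
  have gconst u : u \in porbit s x -> g u = c.
    have sC : {in porbit s x &, forall v w,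
        s v = s w \/ s v \in porbit s x /\ s w \in porbit s x}.
      by move=> v w vC wC; right; rewrite !mem_porbitS.
    by move=> uC; case: (Con_le_block sg sC uC (porbit_id s x)) => [|[_ /(negP cC)]].
  have gout y : y \notin porbit s x ->
      g y = c \/ s y = y /\ y = c /\ g y \in porbit s x.
    move=> yC; have [h [h_on h_off]] := Con_le_orbit_map sg sx yC.
    rewrite -/c h_off //; have [gyC|gyC] := boolP (g y \in porbit s x); last first.
      by rewrite h_off //; left.
    case/porbitP: (gyC) => i gy; rewrite gy h_on => cy; right.
    (* Testing y against s x as well as x shows that c is fixed by s. *)
    have xC : porbit s (s x) = porbit s x by apply: (porbit_perm s 1).
    have ssx : s (s x) != s x by rewrite (inj_eq perm_inj).
    have [|h' [h'_on h'_off]] := @Con_le_orbit_map g (s x) y sg ssx; first by rewrite xC.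
    have gsx : g (s x) = c by apply: gconst; rewrite -xC porbit_id.
    rewrite gsx (h'_off c) ?xC // => e.
    have sc : s c = c.
      have ip : 0 < i + p by rewrite addn_gt0 (prime_gt0 pP) orbT.
      have sip : (s ^+ (i + p) = s ^+ i)%g by rewrite expgD sp mulg1.
      have gy' : g y = (s ^+ (i + p).-1)%g (s x).
        by rewrite gy -permM -expgS prednK // sip.
      by move: e; rewrite gy' h'_on => {1}->; rewrite perm_expS prednK // sip.
    have sy : s y = y.
      apply/eqP/negPn/negP => /(@moved_porbit y c); rewrite sc eqxx => H.
      by have := H _; rewrite cy mem_porbit => /(_ isT).
    by split=> //; rewrite cy perm_exp_fix.
  (* A second nontrivial cycle excludes the remaining alternative of gout. *)
  have [d sd dC] : exists2 d, s d != d & d \notin porbit s x.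
    have [x0C|x0C] := boolP (x0 \in porbit s x); last by exists x0.
    by exists y0 => //; move: x0C yx0; rewrite -eq_porbit_mem => /eqP->.
  have gd : g d = c.
    by case: (gout d dC) => // -[e _]; rewrite e eqxx in sd.
  case: gN; right; exists c => y; have [/gconst//|yC] := boolP (y \in porbit s x).
  have [//|[sy [yc gyC]]] := gout y yC.
  have yD : y \notin porbit s d.
    by rewrite porbit_sym; apply: contra sd => /porbitP[i ->]; rewrite !perm_exp_fix ?sy.
  have [h [_ h_off]] := Con_le_orbit_map sg sd yD.
  rewrite gd h_off -?yc // h_off //.
  by apply: contra dC; move: gyC; rewrite -!eq_porbit_mem => /eqP->; rewrite eq_sym.
have gfix y : s y = y -> g y = y.
  move=> sy.
  have gy x : s x != x -> g y = y \/ g y \in porbit s x.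
    move=> sx; have yC : y \notin porbit s x.
      by rewrite porbit_sym; apply: contra sx => /porbitP[i ->]; rewrite !perm_exp_fix ?sy.
    have [h [h_on h_off]] := Con_le_orbit_map sg sx yC.
    case/porbitP: (gC x sx) => i ->; rewrite h_on perm_exp_fix // => e.
    by have [|gyC] := boolP (g y \in porbit s x); [right | left; rewrite -(h_off _ gyC)].
  have [//|gyx] := gy x0 sx0; have [//|gyy] := gy y0 sy0.
  by case/negP: yx0; move: gyx gyy; rewrite -!eq_porbit_mem => /eqP-> /eqP->.
have gspread i x y : s x != x -> y \notin porbit s x ->
    g x = (s ^+ i)%g x -> g y = (s ^+ i)%g y.
  move=> sx yC gx; have [h [h_on h_off]] := Con_le_orbit_map sg sx yC.
  rewrite gx h_on h_off //; have [/eqP/gfix->//|sy] := boolP (s y == y).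
  by move: (gC y sy) yC; rewrite -!eq_porbit_mem => /eqP->.
have [i gx0] := porbitP _ _ _ (gC x0 sx0).
have gE y : g y = (s ^+ i)%g y.
  have [yC|yC] := boolP (y \in porbit s x0); last exact: gspread yC gx0.
  apply: (gspread i y0) => //; last exact: gspread gx0.
  by rewrite porbit_sym; move: yC yx0; rewrite -!eq_porbit_mem => /eqP->.
have pi : ~~ (p %| i).
  apply/negP => /dvdnP[m im]; case: gN; left=> y.
  by rewrite gE im mulnC expgM sp expg1n perm1.
have [m sE] := expg_prime_root pP sp pi.
apply: Con_le_eq (@Con_le_iter _ g m) => y.
by rewrite -[in RHS]sE permX; apply: eq_iter.
Qed.

End Perm.
End PrimeOrder.

(** * Passing from a nontrivial map to one of the three types *)

Section Above.

Variable A : finType.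
Hypothesis A3 : 3 <= #|A|.
Implicit Types (f g h : A -> A) (x y z : A).

Definition type_I_II_III (f : {ffun A -> A}) := type_I f \/ type_II f \/ type_III f.

Lemma trivial_funP f : reflect (trivial_fun f)
  ([forall x, f x == x] || [exists c, forall x, f x == c]).
Proof.
apply: (iffP orP) => [[/forallP f1|/existsP[c /forallP fc]]|[f1|[c fc]]].
- by left=> x; apply/eqP.
- by right; exists c => x; apply/eqP.
- by left; apply/forallP=> x; rewrite f1.
- by right; apply/existsP; exists c; apply/forallP=> x; rewrite fc.
Qed.

Lemma third x y : exists z, z != x /\ z != y.
Proof.
have /subsetPn[z _] : ~~ (setT \subset [set x; y]).
  apply: contraL A3 => /subset_leq_card le; rewrite -ltnNge ltnS -cardsT.
  by rewrite (leq_trans le) // cards2; case: eqP.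
by rewrite !inE negb_or => /andP[]; exists z.
Qed.

(** The iterates of [f] are eventually periodic, with some period [d] from some
    index [i] on; a positive multiple of [d] beyond [i] works. *)
Lemma iter_idempotent f :
  exists2 n, 0 < n & iter n f \o iter n f =1 iter n f.
Proof.
pose F (g : {ffun A -> A}) := [ffun x => f (g x)].
have FE n : iter n F (finfun id) = [ffun x => iter n f x].
  by elim: n => [|n /= ->]; apply/ffunP => x; rewrite !ffunE.
have /trajectP[i lt_i_n eqF] := looping_order F (finfun id).
set n := fingraph.order _ _ in lt_i_n eqF.
have per x : iter n f x = iter i f x.
  by have := congr1 (fun g : {ffun A -> A} => g x) eqF; rewrite !FE !ffunE.
pose d := n - i; have d_gt0 : 0 < d by rewrite subn_gt0.
have per_d a x : i <= a -> iter (d + a) f x = iter a f x.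
  move=> ia; rewrite -(subnKC ia) addnA (subnK (ltnW lt_i_n)).
  by rewrite iterD per -iterD.
have per_md m a x : i <= a -> iter (m * d + a) f x = iter a f x.
  move=> ia; elim: m => // m IH.
  by rewrite mulSn -addnA per_d // (leq_trans ia) ?leq_addl.
exists (i.+1 * d) => [|x /=]; first by rewrite muln_gt0.
by rewrite -iterD per_md // (leq_trans (leqnSn i)) // leq_pmulr.
Qed.

Lemma idempotent_above f g : g \o g =1 g -> ~ trivial_fun g -> Con_le f g ->
  exists h : {ffun A -> A}, type_I_II_III h /\ Con_le f h.
Proof.
move=> gg gN fg; exists (finfun g); split; last first.
  by apply: Con_le_eq fg => x; rewrite ffunE.
left; split=> [gT|x]; last by rewrite /= !ffunE; apply: gg.
case: gN; case: gT => [g1|[c gc]]; first by left=> x; rewrite -[RHS]g1 ffunE.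
by right; exists c => x; rewrite -(gc x) ffunE.
Qed.

(** If the zero set of [g] has only two elements, they are [o] and the single
    nonzero value [g w]. A congruence relating a zero to a nonzero of [g] then
    relates [o] to [g w], so the retraction onto [{o, g w}] sending all other
    points to [g w] preserves it. *)
Lemma square_const_above g o : (forall x, g (g x) = o) -> ~ trivial_fun g ->
  exists h : {ffun A -> A}, type_I_II_III h /\ Con_le g h.
Proof.
move=> gg gN; pose Z := [set x | g x == o].
have ggo : g o = o by rewrite -{1}(gg o) gg.
have gZ x : g x \in Z by rewrite inE gg.
have oZ : o \in Z by rewrite inE ggo.
have [Z3|Z2] := leqP 3 #|Z|.
  exists (finfun g); split; last by move=> k _ _ _ kg x y; rewrite !ffunE; apply: kg.
  right; left; split=> [gT|].
    case: gN; case: gT => [g1|[c gc]]; first by left=> x; rewrite -[RHS]g1 ffunE.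
    by right; exists c => x; rewrite -(gc x) ffunE.
  exists o; split=> [x|]; first by rewrite /= !ffunE.
  by under eq_finset => x do rewrite !ffunE ggo.
have [w gw] : exists w, g w != o.
  apply/existsP; rewrite -negb_forall; apply/negP => /forallP gc.
  by case: gN; right; exists o => x; apply/eqP.
have ZE : Z = [set o; g w].
  apply/esym/eqP; rewrite eqEcard cards2 eq_sym gw -ltnS Z2 andbT.
  by apply/subsetP => _ /set2P[]->.
pose h x := if x \in Z then x else g w.
have hZ x : x \in Z -> h x = x by rewrite /h => ->.
have hw x : x \notin Z -> h x = g w by rewrite /h => /negPf->.
apply: (@idempotent_above g h).
- move=> x /=; have [xZ|xZ] := boolP (x \in Z); first by rewrite !hZ.
  by rewrite (hw x xZ) hZ.
- case=> [h1|[c hc]].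
    have [z [zo zw]] := third o (g w).
    have zZ : z \notin Z by rewrite ZE !inE negb_or zo.
    by move: zw; rewrite -{1}(h1 z) hw // eqxx.
  by move: gw; rewrite -[g w]hZ // hc -(hc o) hZ // eqxx.
- move=> k kr ks kt kg.
  have mixed u v : u \in Z -> v \notin Z -> k u v -> k (h u) (h v).
    move=> uZ vZ /[dup] kuv /kg; rewrite (hZ u uZ) (hw v vZ).
    have -> : g v = g w.
      have := gZ v; rewrite ZE => /set2P[] // gv.
      by rewrite inE gv eqxx in vZ.
    by move: (uZ); rewrite inE => /eqP->; move: uZ; rewrite ZE => /set2P[]-> // _.
  move=> u v kuv; have [uZ|uZ] := boolP (u \in Z); have [vZ|vZ] := boolP (v \in Z).
  + by rewrite !hZ.
  + exact: mixed.
  + by rewrite ks; apply: mixed => //; rewrite ks.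
  + by rewrite !hw.
Qed.

(** The last non-constant iterate has a constant square, since its exponent is
    positive. *)
Lemma nilpotent_above f n c : ~ trivial_fun f -> (forall x, iter n f x = c) ->
  exists h : {ffun A -> A}, type_I_II_III h /\ Con_le f h.
Proof.
move=> fN fc; pose cst n := [exists c, forall x, iter n f x == c].
have ex_cst : exists n, cst n.
  by exists n; apply/existsP; exists c; apply/forallP => x; rewrite fc.
case: (ex_minnP ex_cst) => -[|[|m]] /existsP[o /forallP/(_ _)/eqP mo] m_min.
- by case: fN; right; exists o => x; apply: mo.
- by case: fN; right; exists o => x; apply: mo.
have gg x : iter m.+1 f (iter m.+1 f x) = o by rewrite -iterD addSnnS addnC iterD mo.
have gN : ~ trivial_fun (iter m.+1 f).
  have not_cst : ~ exists c, forall x, iter m.+1 f x = c.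
    case=> d gd; suff /m_min : cst m.+1 by rewrite ltnn.
    by apply/existsP; exists d; apply/forallP=> x; apply/eqP.
  by case=> // g1; apply: not_cst; exists o => x; rewrite -[RHS](gg x) [RHS]g1.
have [h [lh gh]] := square_const_above gg gN.
by exists h; split=> //; apply: Con_le_trans gh; apply: Con_le_iter.
Qed.

Lemma compatible_iter f (k : rel A) x n : reflexive k -> transitive k ->
  compatible f k -> k x (f x) -> k x (iter n f x).
Proof.
move=> kr kt kf kx; elim: n => [|n IH]; first exact: kr.
by apply: (kt (f x)) => //; apply: kf.
Qed.

Lemma card_moved_porbit (s : {perm A}) p x : prime p -> (s ^+ p = 1)%g ->
  s x != x -> #|porbit s x| = p.
Proof.
move=> pP sp sx; have s1 : (s != 1)%g by apply: contraNneq sx => ->; rewrite perm1.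
have os := nt_prime_order pP sp s1.
have -> : porbit s x = [set (s ^+ i)%g x | i : 'I_p].
  apply/setP => y; apply/idP/imsetP => [/porbitPmin[i]|[i _ ->]]; last exact: mem_porbit.
  by rewrite os => lt_i ->; exists (Ordinal lt_i).
rewrite card_imset ?card_ord // => i j /(moved_expg_inj pP sp sx)/eqP.
by rewrite eq_expg_mod_order os !modn_small // => /eqP/val_inj.
Qed.

(** Suppose that there is just one nontrivial cycle [C]. A congruence relating a
    point of [C] to a fixed point contains all of [C] in that block, so if there
    are fixed points, collapsing [C] to one of its elements and fixing the rest
    preserves all congruences. If [C] is all of [A], primality leaves only the
    two trivial congruences, and any nontrivial idempotent map will do. *)
Lemma prime_perm_above (s : {perm A}) p : prime p -> (s ^+ p = 1)%g -> s != 1%g ->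
  exists h : {ffun A -> A}, type_I_II_III h /\ Con_le s h.
Proof.
move=> pP sp s1.
have [x0 sx0] : exists x, s x != x.
  apply/existsP; rewrite -negb_forall; apply: contra s1 => /forallP s1.
  by apply/eqP/permP => x; rewrite perm1; apply/eqP.
set C := porbit s x0.
have [y0 /andP[sy0 y0C] | fixC] := pickP [pred y | (s y != y) && (y \notin C)].
  exists (finfun s); split; last by move=> k _ _ _ ks x y; rewrite !ffunE; apply: ks.
  right; right; exists p; split=> //.
    move=> x; rewrite -[RHS](perm1 x) -sp permX.
    by apply: eq_iter => z; rewrite ffunE.
  exists s => [x|]; first by rewrite ffunE.
  apply/card_gt1P; exists C, (porbit s y0); split.
  - by rewrite inE imset_f //= (card_moved_porbit pP sp sx0).
  - by rewrite inE imset_f //= (card_moved_porbit pP sp sy0).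
  - by rewrite eq_sym eq_porbit_mem.
have {}fixC y : y \notin C -> s y = y.
  by move=> yC; have := fixC y; rewrite /= yC andbT => /negbT/negPn/eqP.
have [z zC|CT] := pickP (fun z => z \notin C).
  pose h y := if y \in C then x0 else y.
  have hC y : y \in C -> h y = x0 by rewrite /h => ->.
  have hN y : y \notin C -> h y = y by rewrite /h => /negPf->.
  have x0C : x0 \in C := porbit_id s x0.
  apply: (@idempotent_above s h).
  - move=> y /=; have [yC|yC] := boolP (y \in C); last by rewrite !hN.
    by rewrite !hC.
  - case=> [h1|[c hc]].
      by move: sx0; rewrite -(h1 (s x0)) hC ?mem_porbitS // eqxx.
    by case/negP: (zC); rewrite -(hN z zC) hc -(hc x0) hC // x0C.
  - move=> k kr ks kt kf.
    have mixed u v : u \in C -> v \notin C -> k u v -> k (h u) (h v).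
      move=> uC vC kuv; rewrite hC // hN //.
      have /porbitP[n ->] : x0 \in porbit s u by rewrite porbit_sym.
      have <- : iter n s v = v by rewrite -permX perm_exp_fix // fixC.
      by rewrite permX; apply: Con_le_iter kuv.
    move=> u v kuv; have [uC|uC] := boolP (u \in C); have [vC|vC] := boolP (v \in C).
    + by rewrite !hC.
    + exact: mixed.
    + by rewrite ks; apply: mixed => //; rewrite ks.
    + by rewrite !hN.
have {}CT y z : y \in porbit s z.
  have CTy w : w \in C by apply/negPn; rewrite CT.
  by move: (CTy y) (CTy z); rewrite -!eq_porbit_mem => /eqP-> /eqP->.
pose h y := if y == x0 then s x0 else y.
have hx0 : h x0 = s x0 by rewrite /h eqxx.
have hN y : y != x0 -> h y = y by rewrite /h => /negPf->.
apply: (@idempotent_above s h).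
- move=> y /=; have [->|yC] := eqVneq y x0; last by rewrite !hN.
  by rewrite hx0 hN.
- case=> [h1|[c hc]]; first by move: sx0; rewrite -hx0 h1 eqxx.
  have [z [zx zs]] := third x0 (s x0).
  by move: zs; rewrite -{1}(hN z zx) hc -(hc x0) hx0 eqxx.
- move=> k kr ks kt kf u v; have [->//|uv] := eqVneq u v.
  have /porbitP[d vE] := CT v u; rewrite {}vE in uv * => kuv.
  have pd : ~~ (p %| d).
    apply: contraNN uv => /dvdnP[m ->].
    by rewrite mulnC expgM sp expg1n perm1.
  have [m sE] := expg_prime_root pP sp pd.
  have kus : k u (s u).
    rewrite -{1}sE permX; apply: compatible_iter => // x y.
    by rewrite !permX; apply: Con_le_iter.
  have ku w : k u w.
    by have /porbitP[i ->] := CT w u; rewrite permX; apply: compatible_iter.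
  by apply: (kt u) => //; rewrite ks.
Qed.

(** Replace [s] by a power of prime order. *)
Lemma perm_above (s : {perm A}) : s != 1%g ->
  exists h : {ffun A -> A}, type_I_II_III h /\ Con_le s h.
Proof.
move=> s1; have os1 : 1 < #[s]%g by rewrite order_gt1.
have pP := pdiv_prime os1; set p := pdiv _ in pP.
pose n := #[s]%g %/ p.
have np : n * p = #[s]%g by rewrite divnK ?pdiv_dvd.
have n_gt0 : 0 < n by rewrite -(ltn_pmul2r (prime_gt0 pP)) mul0n np ltnW.
have snp : ((s ^+ n) ^+ p = 1)%g by rewrite -expgM np expg_order.
have sn1 : (s ^+ n)%g != 1%g.
  rewrite -order_dvdn -np; apply/negP => /(dvdn_leq n_gt0).
  by rewrite leqNgt ltn_Pmulr ?prime_gt1.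
have [h [lh sh]] := prime_perm_above pP snp sn1.
exists h; split=> //; apply: Con_le_trans sh.
by apply: Con_le_eq (@Con_le_iter _ s n) => x; rewrite permX.
Qed.

Lemma nontrivial_above f : ~ trivial_fun f ->
  exists h : {ffun A -> A}, type_I_II_III h /\ Con_le f h.
Proof.
move=> fN; have [n n_gt0 fn] := iter_idempotent f.
have [[fn1|[c fc]]|fnN] := trivial_funP (iter n f); last 1 first.
- exact: idempotent_above fn fnN (@Con_le_iter _ f n).
- have f_inj : injective f.
    move=> x y fxy; rewrite -(fn1 x) -(fn1 y).
    by rewrite -(prednK n_gt0) !iterSr fxy.
  pose s := perm f_inj; have sf : s =1 f by move=> x; rewrite permE.
  have [|h [lh sh]] := @perm_above s.
    apply/negP => /eqP s1; case: fN; left=> x.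
    by rewrite -sf s1 perm1.
  exists h; split=> //; apply: Con_le_trans sh.
  by apply: (@Con_le_eq _ f f) => // k _ _ _; apply.
- exact: nilpotent_above fN fc.
Qed.

End Above.

(** * The coatoms *)

Section Coatoms.

Variable A : finType.
Implicit Types (f g : {ffun A -> A}) (F : {set {ffun A -> A}}) (L : {set {set A * A}}).

(** The number of cycles of length [p] is used only through two moved points in
    different orbits. *)
Lemma type_III_orbits f : type_III f -> exists (s : {perm A}) p x y,
  [/\ f =1 s, prime p, (s ^+ p = 1)%g & [/\ s x != x, s y != y & y \notin porbit s x]].
Proof.
case=> p [pP fp [s fs /card_gt1P[C [D []]]]].
rewrite !inE => /andP[/imsetP[x _ ->] /eqP Cp] /andP[/imsetP[y _ ->] /eqP Dp] CD.
have moved z : #|porbit s z| = p -> s z != z.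
  move=> zp; apply: contraTN (prime_gt1 pP) => /eqP sz; rewrite -leqNgt -zp -(cards1 z).
  by apply/subset_leq_card/subsetP => _ /porbitP[i ->]; rewrite perm_exp_fix ?set11.
exists s, p, x, y; split=> //; first last.
  by split; [exact: moved | exact: moved | rewrite -eq_porbit_mem eq_sym].
by apply/permP => z; rewrite perm1 permX -[RHS]fp; apply/esym/eq_iter.
Qed.

Lemma type_I_II_III_nontrivial f : type_I_II_III f -> ~ trivial_fun f.
Proof.
case=> [[]|[[]|/type_III_orbits[s [p [x [_ [fs _ _ [sx _ _]]]]]]]] //.
case=> [f1|[c fc]]; first by rewrite -fs f1 eqxx in sx.
by rewrite -(inj_eq (@perm_inj _ s)) -!fs !fc eqxx in sx.
Qed.

Lemma type_I_II_III_max f g :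
  type_I_II_III f -> ~ trivial_fun g -> Con_le f g -> Con_le g f.
Proof.
case=> [[fN ff]|[[fN [o [ff Z3]]]|/type_III_orbits[s [p [x [y [fs pP sp [sx sy yx]]]]]]]].
- exact: idempotent_max.
- have fo : f o = o := etrans (congr1 f (esym (ff o))) (ff (f o)).
  by rewrite fo in Z3; exact: (square_const_max (ff : forall x, f (f x) = o) Z3 fN).
- move=> gN fg; apply: (Con_le_eq (g := s)) => [z|]; first by rewrite fs.
  apply: (prime_perm_max pP sp sx sy yx gN) => k kr ks kt kf.
  by apply: fg => // u v; rewrite !fs; apply: kf.
Qed.

Lemma Con_sub_Con1 F f : f \in F -> Con F \subset Con1 f.
Proof.
move=> fF; apply/subsetP => kappa; rewrite !inE => /andP[-> /forall_inP kF].
by apply/forall_inP => g /set1P->; apply: kF.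
Qed.

Lemma trivial_Con1 f : trivial_fun f -> Eq A \subset Con1 f.
Proof.
move=> fT; apply/subsetP => kappa; rewrite inE => keq; apply/Con1P; split=> //.
have [kr _ _] := is_equivP _ keq.
case: fT => [f1|[c fc]] x y kxy; first by rewrite !f1.
by rewrite !fc; apply: kr.
Qed.

Lemma Con_neq_Eq F : Con F != Eq A -> exists2 f, f \in F & ~ trivial_fun f.
Proof.
move=> FN; have [/forall_inP FT|] :=
  boolP [forall f in F, [forall x, f x == x] || [exists c, forall x, f x == c]].
  case/eqP: FN; apply/setP => kappa; rewrite inE andb_idr // => keq.
  apply/forall_inP => f fF.
  have /subsetP/(_ kappa keq) := trivial_Con1 (trivial_funP f (FT f fF)).
  by rewrite inE keq => /forall_inP; apply; rewrite set11.
rewrite negb_forall_in => /exists_inP[f fF /trivial_funP fN].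
by exists f.
Qed.

Lemma nontrivial_Con1_proper f : 3 <= #|A| -> ~ trivial_fun f -> Con1 f \proper Eq A.
Proof.
move=> A3 fN; rewrite properE; apply/andP; split.
  by apply/subsetP => kappa; rewrite inE => /andP[].
apply/negP => /subsetP Ef; apply: fN; apply: nontrivial_Con_id => //.
have id_f : Con_le (finfun (@id A)) f.
  by apply/Con1_sub/subsetP => kappa; rewrite inE => /andP[/Ef].
by move=> k kr ks kt _; apply: id_f => // x y; rewrite !ffunE.
Qed.

End Coatoms.

Theorem theorem4p3 (A : finType) (hA : 3 <= #|A|) (L : {set {set A * A}}) :
  coatom L <->
  exists f : {ffun A -> A},
    (type_I f \/ type_II f \/ type_III f) /\ L = Con1 f.
Proof.
split=> [[/imsetP[F _ ->] _ FE cover] | [f [fL ->]]].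
  have [f fF fN] := Con_neq_Eq (proper_neq FE).
  have [h [hL fh]] := nontrivial_above hA fN; exists h; split=> //.
  have Fh : Con F \subset Con1 h.
    by apply: subset_trans (Con_sub_Con1 fF) _; apply/Con1_sub.
  have hP : Con1 h \in cong_lattices A by apply: imset_f.
  have := cover _ hP.
  rewrite nontrivial_Con1_proper ?andbT //; last exact: type_I_II_III_nontrivial.
  by rewrite properE Fh => /negPn hF; apply/eqP; rewrite eqEsubset Fh.
have fN := type_I_II_III_nontrivial fL.
split.
- exact: imset_f.
- exact: Eq_in_cong_lattices.
- exact: nontrivial_Con1_proper.
- move=> _ /imsetP[F _ ->]; apply/negP => /andP[fF /proper_neq/Con_neq_Eq[g gF gN]].
  have Fg := Con_sub_Con1 gF.
  have fg : Con_le f g by apply/Con1_sub; apply: subset_trans Fg; apply: proper_sub.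
  have /Con1_sub gf := type_I_II_III_max fL gN fg.
  by case/negP: (proper_subn fF); apply: subset_trans gf.
Qed.
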